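(* Let $V$ be a vertex algebra, let $g$ be an automorphism of $V$ with period $T$, and let $W$ be a $g$-twisted $V$-module. If $V$ and $W$ are $C_2$-cofinite, then $W$ is $E_n$-cofinite and $C_{n+2}$-cofinite for all $n\ge0$.
   Context: Vertex algebras are over $\mathbb{C}$; a vertex algebra $V$ has vertex operators $Y(v,x)=\sum_{n\in\mathbb{Z}}v_nx^{-n-1}$ ($v_n\in\mathrm{End}\,V$) and vacuum $\mathbf{1}$. An automorphism of $V$ is a linear isomorphism $g$ with $gY(v,x)g^{-1}=Y(g(v),x)$ for all $v\in V$; it has period $T$ ($T$ a positive integer) if $g^T=1$. Then $V=\bigoplus_{r=0}^{T-1}V^r$ with $V^r=\{v\in V: g(v)=e^{2\pi i r/T}v\}$. A $g$-twisted $V$-module is a vector space $W$ with a linear map $Y_W(\cdot,x):V\to(\mathrm{End}\,W)[[x^{1/T},x^{-1/T}]]$, $Y_W(v,x)=\sum_{n\in\frac1T\mathbb{Z}}v_nx^{-n-1}$, such that for $u\in V^r$ ($0\le r\le T-1$), $v\in V$, $w\in W$: $Y_W(u,x)=\sum_{n\in\frac rT+\mathbb{Z}}u_nx^{-n-1}$; $u_nw=0$ for $n\in\frac rT+\mathbb{Z}$ sufficiently large; $Y_W(\mathbf{1},x)=\mathrm{Id}_W$; and $$x_0^{-1}\delta\left(\tfrac{x_1-x_2}{x_0}\right)Y_W(u,x_1)Y_W(v,x_2)w-x_0^{-1}\delta\left(\tfrac{x_2-x_1}{-x_0}\right)Y_W(v,x_2)Y_W(u,x_1)w=x_2^{-1}\left(\tfrac{x_1-x_0}{x_2}\right)^{-\frac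 rT}\delta\left(\tfrac{x_1-x_0}{x_2}\right)Y_W(Y(u,x_0)v,x_2)w,$$ where $\delta(x)=\sum_{n\in\mathbb{Z}}x^n$ and binomials are expanded in nonnegative integral powers of the second variable. $V$ is $C_2$-cofinite if $V/C_2(V)$ is finite-dimensional, where $C_2(V)=\mathrm{span}\{u_{-2}v: u,v\in V\}$. $E_n^T(W)$ ($n\in\mathbb{Z}$) is the linear span of all $u^{(1)}_{-1-k_1+\frac{r_1}{T}}\cdots u^{(s)}_{-1-k_s+\frac{r_s}{T}}w$ with $s\ge1$, $u^{(i)}\in V^{r_i}$, $0\le r_i\le T-1$, $w\in W$, $k_i\ge0$, $k_1+\cdots+k_s-\frac{r_1+\cdots+r_s}{T}\ge\frac nT$. For $n\ge2$, $C_n^T(W)=\mathrm{span}\{u_{-n+\frac pT}w: u\in V^p,\ w\in W,\ p=0,1,\dots,T-1\}$. $W$ is $C_n$-cofinite if $W/C_n^T(W)$ is finite-dimensional, and $E_n$-cofinite if $W/E_n^T(W)$ is finite-dimensional. *)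

(* Defs.v *)
From HB Require Import structures.
From mathcomp Require Import all_boot all_order all_algebra.
From mathcomp Require Import complex.
From mathcomp Require Import all_classical all_reals all_analysis.

Set Implicit Arguments.
Unset Strict Implicit.
Unset Printing Implicit Defensive.

Import Order.TTheory GRing.Theory Num.Theory.

Local Open Scope classical_set_scope.
Local Open Scope ring_scope.

(* The complex numbers are R[i] for an arbitrary R : realType.  A family of
   modes (v_n) with n in (1/T)Z is encoded by the numerators of its indices:
   for k : int, mode k v stands for v_(k/T).  In the untwisted case T = 1 and
   the numerator is the index itself. *)

Section Linear.
Variables (R : realType) (U : lmodType R[i]).

Definition lspan (A : set U) : set U :=
  [set x | exists m (c : 'I_m -> R[i]) (a : 'I_m -> U),
      (forall i, A (a i)) /\ x = \sum_i c i *: a i].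

(* U/S is finite-dimensional: it is spanned by the classes of finitely many
   vectors e i. *)
Definition finite_codim (S : set U) : Prop :=
  exists m (e : 'I_m -> U), forall x, exists c : 'I_m -> R[i],
    S (x - \sum_i c i *: e i).

End Linear.

Section Jacobi.
Variable R : realType.

Definition gbinom (z : R[i]) (j : nat) : R[i] :=
  (\prod_(i < j) (z - i%:R)) / (j`!)%:R.

(* [jacobi_identity T r YV YW u v w] is the twisted Jacobi identity for u in V^r.
   Both sides are formal series in x0, x1^(1/T), x2^(1/T) and they are compared
   coefficientwise, at x0^(-l-1) x1^(-a/T-1) x2^(-b/T-1).  The first two delta
   functions are expanded as
     x0^-1 delta((x1-x2)/x0)
       = \sum_(n,i) (-1)^i binom(n,i) x0^(-n-1) x1^(n-i) x2^i,
     x0^-1 delta((x2-x1)/(-x0))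
       = \sum_(n,i) (-1)^(n+i) binom(n,i) x0^(-n-1) x2^(n-i) x1^i,
   where n is forced to be l.  The factor on the right-hand side is
     x2^-1 ((x1-x0)/x2)^(-r/T) delta((x1-x0)/x2)
       = \sum_(n,j) (-1)^j binom(n-r/T,j) x1^(n-r/T-j) x0^j x2^(-n+r/T-1);
   comparing exponents of x1 gives n - r/T = j - 1 - a/T, which has a solution
   n in Z exactly when T divides a - r.
   The sums over i and j are finitely supported sums (0 otherwise); their
   supports are finite by the truncation axioms below. *)
Definition jacobi_identity (T r : nat) (V W : lmodType R[i])
    (YV : int -> V -> V -> V) (YW : int -> V -> W -> W) (u v : V) (w : W) :=
  forall l a b : int,
    \sum_(i \in [set: nat]) ((-1) ^+ i * gbinom l%:~R i) *:
        YW (a + (l - i%:Z) * T%:Z) u (YW (b + i%:Z * T%:Z) v w)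
    - \sum_(i \in [set: nat]) ((-1) ^ (l + i%:Z) * gbinom l%:~R i) *:
        YW (b + (l - i%:Z) * T%:Z) v (YW (a + i%:Z * T%:Z) u w)
    = if (T%:Z %| a - r%:Z)%Z then
        \sum_(j \in [set: nat])
          ((-1) ^+ j * gbinom (j%:R - 1 - a%:~R / T%:R) j) *:
            YW (a + b - j%:Z * T%:Z) (YV (l + j%:Z) u v) w
      else 0.

End Jacobi.

Record vertexAlgebra (R : realType) := VertexAlgebra {
  va_space :> lmodType R[i];
  va_mode : int -> {bilinear va_space -> va_space -> va_space};
  va_vac : va_space;
  va_trunc : forall u v : va_space,
    exists N : int, forall n, N <= n -> va_mode n u v = 0;
  va_vacuum : forall n (v : va_space),
    va_mode n va_vac v = if n == -1 then v else 0;
  va_creation : forall v : va_space,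
    va_mode (-1) v va_vac = v /\ forall n, 0 <= n -> va_mode n v va_vac = 0;
  va_jacobi : forall u v w : va_space,
    jacobi_identity 1 0 (fun n x => va_mode n x) (fun n x => va_mode n x) u v w
}.

Section Twisted.
Variables (R : realType) (V : vertexAlgebra R).

(* The second condition is g Y(v,x) = Y(g v,x) g, coefficientwise. *)
Definition va_automorphism (g : {linear V -> V}) : Prop :=
  bijective g /\
  forall n (v w : V), g (va_mode V n v w) = va_mode V n (g v) (g w).

Definition has_period (g : V -> V) (T : nat) : Prop :=
  (0 < T)%N /\ forall v, iter T g v = v.

Definition exp_2ipi (T r : nat) : R[i] :=
  let t := 2 * pi * r%:R / T%:R in Complex (cos t) (sin t).

Definition eigen (g : V -> V) (T r : nat) : set V :=
  [set v | g v = exp_2ipi T r *: v].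

Record twistedModule (g : V -> V) (T : nat) := TwistedModule {
  tw_space :> lmodType R[i];
  tw_mode : int -> {bilinear V -> tw_space -> tw_space};
  tw_support : forall (r : 'I_T) u, eigen g T r u ->
    forall k, ~~ (T%:Z %| k - r%:Z)%Z -> forall w, tw_mode k u w = 0;
  tw_trunc : forall (r : 'I_T) u, eigen g T r u ->
    forall w, exists N : int, forall k, N <= k -> tw_mode k u w = 0;
  tw_vacuum : forall k w,
    tw_mode k (va_vac V) w = if k == - T%:Z then w else 0;
  tw_jacobi : forall (r : 'I_T) u, eigen g T r u -> forall v w,
    jacobi_identity T r (fun n x => va_mode V n x) (fun k x => tw_mode k x) u v w
}.

Definition va_C2 : set V :=
  lspan [set x | exists u v : V, x = va_mode V (- 2) u v].

Variables (g : V -> V) (T : nat) (W : twistedModule g T).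

(* Only meant for n >= 2; -n + p/T has numerator -nT + p. *)
Definition tw_C (n : nat) : set W :=
  lspan [set x | exists (p : 'I_T) (u : V) (w : W),
    eigen g T p u /\ x = tw_mode W (- (n%:Z * T%:Z) + p%:Z) u w].

(* A factor (u, r, k) stands for u_(-1-k+r/T). *)
Definition tw_word (s : seq (V * 'I_T * nat)) (w : W) : W :=
  foldr (fun (f : V * 'I_T * nat) x =>
    let: (u, r, k) := f in
    tw_mode W ((- 1 - k%:Z) * T%:Z + (r : nat)%:Z) u x) w s.

(* The inequality \sum k_i - (\sum r_i)/T >= n/T is multiplied by T. *)
Definition tw_E (n : int) : set W :=
  lspan [set x | exists (s : seq (V * 'I_T * nat)) (w : W),
    [/\ (1 <= size s)%N,
        {in s, forall f : V * 'I_T * nat, eigen g T f.1.2 f.1.1},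
        n <= \sum_(f <- s) (f.2%:Z * T%:Z - (f.1.2 : nat)%:Z)
      & x = tw_word s w]].

End Twisted.

Arguments va_C2 {R} V _.
Arguments tw_C {R V g T} W n _.
Arguments tw_word {R V g T} W s w.
Arguments tw_E {R V g T} W n _.

(* Main.v *)
Require Import Defs.
From HB Require Import structures.
From mathcomp Require Import all_boot all_order all_algebra.
From mathcomp Require Import complex.
From mathcomp Require Import all_classical all_reals all_analysis.
From mathcomp Require Import zify ring lra.

(* Give u_(k/T) the weight -(k + T), and let D_n be the span of the words in
   modes of positive weight with total weight at least n.  The commutator
   formula shows that every mode of weight a maps D_n into D_(n+a), and the
   iterate formula that modes of elements of C_2(V) gain an additional T.
   Hence D_n/D_(n+1) is spanned by u_(k/T) e with u in a finite set
   representing V/C_2(V), e in a finite set representing W/D_n, and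
   finitely many k.  As D_1 contains C_2^T(W), every D_n has finite
   codimension, and D_n lies in E_n^T(W).
   For the C_n, let K_c be the span of all u_(k/T) w with u_(k/T) of weight at
   least c.  In the formula for (u_(-1)v)_n all products but one have an
   exterior factor of weight > c, so a mode of weight >= c maps K_c into
   K_(c+1).  Moving modes of weight >= c to the left of a word, it
   follows that D_N lies in K_c for N large, and K_c lies in C_m^T(W) for
   c = (m - 2)T + 1. *)

Set Implicit Arguments.
Unset Strict Implicit.
Unset Printing Implicit Defensive.

Import Order.TTheory GRing.Theory Num.Theory.

Local Open Scope classical_set_scope.
Local Open Scope ring_scope.

(** * Subspaces, spans and finite codimension *)

Section Subspaces.
Variables (R : realType) (U : lmodType R[i]).
Implicit Types (A S : set U) (s : seq U).

Definition is_subspace S : Prop :=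
  S 0 /\ forall c x y, S x -> S y -> S (c *: x + y).

Lemma subspaceD S : is_subspace S -> forall x y, S x -> S y -> S (x + y).
Proof. by move=> [_ Slin] x y Sx Sy; rewrite -[x]scale1r; apply: Slin. Qed.

Lemma subspaceZ S : is_subspace S -> forall c x, S x -> S (c *: x).
Proof. by move=> [S0 Slin] c x Sx; rewrite -[_ *: _]addr0; apply: Slin. Qed.

Lemma subspaceB S : is_subspace S -> forall x y, S x -> S y -> S (x - y).
Proof. by move=> [_ Slin] x y Sx Sy; rewrite addrC -scaleN1r; apply: Slin. Qed.

Lemma subspace_sum S : is_subspace S ->
  forall (I : Type) (r : seq I) (P : pred I) (F : I -> U),
  (forall i, P i -> S (F i)) -> S (\sum_(i <- r | P i) F i).
Proof.
by move=> Ss I r P F SF; apply: big_ind => //; [case: Ss | apply: subspaceD].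
Qed.

Lemma subspace_lspan A : is_subspace (lspan A).
Proof.
split; first by exists 0%N, (fun=> 0), (fun=> 0); split=> [[]|]; rewrite ?big_ord0.
move=> c _ _ [m1 [c1 [a1 [Aa1 ->]]]] [m2 [c2 [a2 [Aa2 ->]]]].
exists (m1 + m2)%N.
exists (fun i => match fintype.split i with inl j => c * c1 j | inr j => c2 j end).
exists (fun i => match fintype.split i with inl j => a1 j | inr j => a2 j end).
split=> [i|]; first by case: (fintype.split i).
rewrite big_split_ord scaler_sumr; congr (_ + _); apply: eq_bigr => i _.
  by rewrite (unsplitK (inl i)) scalerA.
by rewrite (unsplitK (inr i)).
Qed.

Lemma lspan_gen A x : A x -> lspan A x.
Proof.
move=> Ax; exists 1%N, (fun=> 1), (fun=> x); split=> //.
by rewrite big_ord1 scale1r.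
Qed.

Lemma lspan_sub A S : is_subspace S -> A `<=` S -> lspan A `<=` S.
Proof.
move=> Ss AS _ [m [c [a [Aa ->]]]].
by apply: (subspace_sum Ss) => i _; apply/(subspaceZ Ss)/AS.
Qed.

Definition span_plus s S : set U :=
  [set x | exists2 y, lspan [set` s] y & S (x - y)].

Lemma subspace_span_plus s S : is_subspace S -> is_subspace (span_plus s S).
Proof.
move=> Ss; have Ls := subspace_lspan [set` s]; split.
  by exists 0; rewrite ?subr0; [case: Ls | case: Ss].
move=> c x y [x' Lx' Sx] [y' Ly' Sy]; exists (c *: x' + y').
  by case: Ls => _; apply.
by rewrite opprD addrACA -scalerBr; case: Ss => _; apply.
Qed.

Lemma span_plus_r s S x : S x -> span_plus s S x.
Proof. by exists 0; rewrite ?subr0 //; case: (subspace_lspan [set` s]). Qed.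

Lemma span_plus_l s S x : S 0 -> lspan [set` s] x -> span_plus s S x.
Proof. by exists x; rewrite ?subrr. Qed.

(** Spanning families become sequences, which can be concatenated and built by comprehension. *)
Lemma finite_codimP S :
  finite_codim S <-> exists s, forall x, span_plus s S x.
Proof.
split=> [[m [e eP]]|[s sP]].
  exists (codom e) => x; have [c Sc] := eP x; exists (\sum_i c i *: e i) => //.
  apply: (subspace_sum (subspace_lspan _)) => i _.
  by apply/(subspaceZ (subspace_lspan _))/lspan_gen/codom_f.
exists (size s), (fun i => nth 0 s i) => x; have [y Ly Sxy] := sP x.
suff [c yE] : exists c : 'I_(size s) -> R[i], y = \sum_i c i *: nth 0 s i.
  by exists c; rewrite -yE.
move: y Ly {Sxy}; apply: lspan_sub => /=.
  split; first by exists (fun=> 0); rewrite big1 // => i _; rewrite scale0r.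
  move=> c _ _ [c1 ->] [c2 ->]; exists (fun i => c * c1 i + c2 i).
  rewrite scaler_sumr -big_split; apply: eq_bigr => i _.
  by rewrite scalerDl scalerA.
move=> y /= ys; have ltis : (index y s < size s)%N by rewrite index_mem.
exists (fun i => (i == Ordinal ltis)%:R).
rewrite (bigD1 (Ordinal ltis)) //= big1 => [|i /negPf->]; last exact: scale0r.
by rewrite eqxx scale1r addr0 nth_index.
Qed.

Lemma finite_codim_sub S S' : S `<=` S' -> finite_codim S -> finite_codim S'.
Proof.
by move=> SS' [m [e eP]]; exists m, e => x; have [c /SS'] := eP x; exists c.
Qed.

Lemma subspace_fsum S (F : nat -> U) : is_subspace S ->
  (forall i, S (F i)) -> S (\sum_(i \in [set: nat]) F i).
Proof. by move=> Ss SF; apply: (subspace_sum Ss). Qed.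

Lemma fsum_nat N (F : nat -> U) : (forall i, (N <= i)%N -> F i = 0) ->
  \sum_(i \in [set: nat]) F i = \sum_(i < N) F i.
Proof.
move=> F0; rewrite (fsbigE (iota 0 N)) ?iota_uniq //; last first.
  by move=> i _; rewrite mem_iota add0n /= -leqNgt; apply: F0.
rewrite -(big_mkord xpredT) /index_iota subn0.
by apply: eq_bigl => i; rewrite in_setT.
Qed.

(** This solves a Jacobi identity for the leading term of one of its sums, modulo a subspace
    containing all later terms. *)
Lemma subspace_fsum_head S N (F : nat -> U) : is_subspace S ->
  (forall i, (N <= i)%N -> F i = 0) -> (forall i, S (F i.+1)) ->
  S (F 0%N - \sum_(i \in [set: nat]) F i).
Proof.
move=> Ss F0 SF; rewrite (@fsum_nat N.+1); last by move=> i /ltnW/F0.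
rewrite big_ord_recl opprD addrA subrr sub0r -scaleN1r.
by apply: (subspaceZ Ss); apply: (subspace_sum Ss) => i _; apply: SF.
Qed.

End Subspaces.

Section GBinom.
Variable R : realType.

Lemma gbinom0r (z : R[i]) : gbinom z 0 = 1.
Proof. by rewrite /gbinom big_ord0 fact0 divr1. Qed.

Lemma gbinom1r (z : R[i]) : gbinom z 1 = z.
Proof. by rewrite /gbinom big_ord1 subr0 divr1. Qed.

Lemma gbinom0l j : gbinom (0 : R[i]) j.+1 = 0.
Proof. by rewrite /gbinom big_ord_recl subr0 !mul0r. Qed.

End GBinom.

(** * Roots of unity and the eigenspaces of $g$ *)

Section RootsOfUnity.
Variable R : realType.

Lemma exp_2ipi0 T : exp_2ipi R T 0 = 1.
Proof. by rewrite /exp_2ipi mulr0 mul0r cos0 sin0. Qed.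

Lemma exp_2ipiD T i j : exp_2ipi R T (i + j) = exp_2ipi R T i * exp_2ipi R T j.
Proof.
rewrite /exp_2ipi natrD mulrDr mulrDl; set a := _ / _; set b := _ / _.
rewrite cosD sinD; apply/eqP; rewrite eq_complex /=; apply/andP; split=> //.
by rewrite addrC.
Qed.

Lemma exp_2ipiE T r : exp_2ipi R T r = exp_2ipi R T 1 ^+ r.
Proof.
elim: r => [|r IH]; first by rewrite exp_2ipi0.
by rewrite -addn1 exp_2ipiD IH exprD.
Qed.

Lemma exp_2ipi_period T : (0 < T)%N -> exp_2ipi R T 1 ^+ T = 1.
Proof.
move=> T0; rewrite -exp_2ipiE /exp_2ipi mulfK ?pnatr_eq0 -?lt0n //.
by rewrite mulr_natl cos2pi sin2pi.
Qed.

(** With t = pi r/T strictly between 0 and pi, the real part is cos 2t = 1 - 2 sin^2 t < 1. *)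
Lemma exp_2ipi_neq1 T r : (0 < r < T)%N -> exp_2ipi R T 1 ^+ r != 1.
Proof.
move=> /andP[r0 rT]; rewrite -exp_2ipiE /exp_2ipi eq_complex /= negb_and.
have T0 : 0 < T%:R :> R by rewrite ltr0n (leq_ltn_trans _ rT).
have -> : 2 * pi * r%:R / T%:R = (pi * (r%:R / T%:R)) *+ 2 :> R.
  by rewrite -[RHS]mulr_natl !mulrA.
rewrite cos_mulr2n; set t := pi * _.
have st : 0 < sin t.
  apply: sin_gt0_pi; rewrite /t mulr_gt0 ?pi_gt0 ?divr_gt0 ?T0 ?ltr0n //=.
  by rewrite gtr_pMr ?pi_gt0 // ltr_pdivrMr // mul1r ltr_nat.
have := cos2Dsin2 t; have : 0 < sin t ^+ 2 by rewrite exprn_gt0.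
move=> s0 cs; apply/orP; left; apply/eqP => c1; lra.
Qed.

Lemma sum_exp_2ipi T r : (r < T)%N ->
  \sum_(j < T) (exp_2ipi R T 1 ^+ r) ^- j = if r == 0%N then T%:R else 0.
Proof.
move=> rT; have T0 := leq_ltn_trans (leq0n r) rT.
case: posnP => [->|r0].
  rewrite -[X in X%:R](card_ord T) -sumr_const; apply: eq_bigr => j _.
  by rewrite expr0 expr1n invr1.
have z1 := @exp_2ipi_neq1 T r; rewrite r0 rT in z1; have {}z1 := z1 isT.
set z := _ ^+ r in z1 *.
have zT : z ^+ T = 1 by rewrite /z -exprM mulnC exprM exp_2ipi_period ?expr1n.
have z0 : z^-1 != 1 by rewrite invr_eq1.
apply: (mulfI (_ : z^-1 - 1 != 0)); first by rewrite subr_eq0.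
rewrite mulr0; under eq_bigr do rewrite -exprVn.
by rewrite -subrX1 exprVn zT invr1 subrr.
Qed.

End RootsOfUnity.

Section Eigen.
Variables (R : realType) (V : vertexAlgebra R) (g : {linear V -> V}) (T : nat).

(** Discrete Fourier transform: the component in V^r is T^-1 \sum_j z^(-rj) g^j v with z = e^(2 pi
    i/T). *)
Lemma eigen_decomposition : has_period g T -> forall v,
  exists2 f : 'I_T -> V, (forall r : 'I_T, eigen g T r (f r)) & v = \sum_r f r.
Proof.
move=> [T0 gT] v; pose z := exp_2ipi R T 1.
have zT : z ^+ T = 1 by exact: exp_2ipi_period.
have z0 : z != 0.
  apply/eqP => z0; move/eqP: zT.
  by rewrite z0 expr0n gtn_eqF // eq_sym oner_eq0.
pose h r j := (z ^+ r) ^- j *: iter j g v.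
exists (fun r => T%:R^-1 *: \sum_(j < T) h (r : nat) j) => [r|].
  rewrite /eigen /= exp_2ipiE -/z linearZ linear_sum scalerA mulrC -scalerA.
  congr (_ *: _).
  have -> : \sum_(j < T) g (h r j) = z ^+ r *: \sum_(j < T) h r j.+1.
    rewrite scaler_sumr; apply: eq_bigr => j _.
    rewrite /h linearZ scalerA exprS invfM mulrA mulfV ?mul1r //.
    by rewrite expf_neq0.
  congr (_ *: _); apply: (addrI (h r 0%N)).
  transitivity (\sum_(j < T.+1) h r j); first by rewrite big_ord_recl.
  rewrite big_ord_recr /= addrC; congr (_ + _).
  by rewrite /h gT -exprM mulnC exprM zT expr1n.
(* Summed over [r] first, the coefficient of g^j v is T for j = 0 and vanishes otherwise. *)
rewrite -scaler_sumr exchange_big /=.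
rewrite (bigD1 (Ordinal T0)) //= [X in _ + X]big1 => [|j j0].
  rewrite addr0 /h -scaler_suml; under eq_bigr do rewrite expr0 invr1.
  by rewrite sumr_const card_ord scalerA mulVf ?scale1r // pnatr_eq0 -lt0n.
rewrite /h -scaler_suml; under eq_bigr do rewrite -exprM mulnC exprM.
rewrite sum_exp_2ipi //; case: eqVneq => [j0'|_]; last by rewrite scale0r.
by case/negP: j0; apply/eqP/val_inj.
Qed.

(** By creation, g(1) = g(1)_(-1) 1 = g(1_(-1) g^-1(1)) = 1. *)
Lemma eigen_vac : va_automorphism g -> eigen g T 0 (va_vac V).
Proof.
move=> [[g' gK g'K] gY]; rewrite /eigen /= exp_2ipi0 scale1r.
have [<- _] := va_creation (g (va_vac V)).
by rewrite -{2}(g'K (va_vac V)) -gY va_vacuum eqxx g'K.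
Qed.

End Eigen.

(** * Modes on the twisted module and their commutators *)

Section TwistedModule.
Variables (R : realType) (V : vertexAlgebra R) (g : {linear V -> V}) (T : nat).
Hypotheses (g_aut : va_automorphism g) (g_period : has_period g T).
Variable W : twistedModule g T.

Local Notation Y := (tw_mode W).

Let T_gt0 : (0 < T)%N. Proof. by case: g_period. Qed.

Lemma is_subspace_mode_l (S : set W) k w :
  is_subspace S -> is_subspace [set u | S (Y k u w)].
Proof.
move=> Ss; split=> [|c x y Sx Sy] /=; first by rewrite linear0l; case: Ss.
by rewrite linearPl; case: Ss => _; apply.
Qed.

Lemma is_subspace_mode_r (S : set W) k u :
  is_subspace S -> is_subspace [set w | S (Y k u w)].
Proof.
move=> Ss; split=> [|c x y Sx Sy] /=; first by rewrite linear0r; case: Ss.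
by rewrite linearPr; case: Ss => _; apply.
Qed.

Lemma eigen_ind (S : set V) : is_subspace S ->
  (forall (r : 'I_T) u, eigen g T r u -> S u) -> forall u, S u.
Proof.
move=> Ss Seig u; have [f fE ->] := eigen_decomposition g_period u.
by apply: (subspace_sum Ss) => r _; apply: (Seig r).
Qed.

Lemma tw_mode_eventually0 (r : 'I_T) v b w : eigen g T r v ->
  exists N : nat, forall i, (N <= i)%N -> Y (b + i%:Z * T%:Z) v w = 0.
Proof.
move=> vr; have [N NP] := tw_trunc vr w.
exists `|N - b|%N => i Ni; apply: NP.
have : i%:Z <= i%:Z * T%:Z by nia.
lia.
Qed.

(** The Jacobi identity at l = 0 is the commutator formula. Its coefficients and the vectors u_j v
    never matter, so the last hypothesis quantifies over all [x]. *)
Lemma tw_commute (S : set W) a b u v w : is_subspace S ->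
  (forall u', S (Y b v (Y a u' w))) ->
  (forall x (j : nat), S (Y (a + b - j%:Z * T%:Z) x w)) ->
  S (Y a u (Y b v w)).
Proof.
move=> Ss Svu Suv; move: u; apply: eigen_ind => [|r u ur].
  exact: is_subspace_mode_l.
have := tw_jacobi ur v w 0 a b.
rewrite (@fsum_nat _ _ 1%N); last by case=> // i _; rewrite gbinom0l mulr0 scale0r.
rewrite (@fsum_nat _ _ 1%N); last by case=> // i _; rewrite gbinom0l mulr0 scale0r.
rewrite !big_ord1 /= subr0 mul0r !addr0 gbinom0r !mulr1 expr0 !scale1r.
move=> /(canRL (subrK _)) ->; apply: (subspaceD Ss) => //.
case: ifP => _; last by case: Ss.
by apply: (subspace_fsum Ss) => j; apply: (subspaceZ Ss).
Qed.

(** * The filtration D_n *)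

(* The constructor [tw_D_triv] reflects that the empty word has weight 0. *)
Inductive tw_D : int -> W -> Prop :=
| tw_D_triv n w : n <= 0 -> tw_D n w
| tw_D_lin n c x y : tw_D n x -> tw_D n y -> tw_D n (c *: x + y)
| tw_D_0 n : tw_D n 0
| tw_D_mode_pos n k u x : k + T%:Z < 0 -> tw_D n x -> tw_D (n - (k + T%:Z)) (Y k u x)
| tw_D_le m n x : m <= n -> tw_D n x -> tw_D m x.

Lemma is_subspace_tw_D n : is_subspace (tw_D n).
Proof. by split=> [|c x y]; [apply: tw_D_0 | apply: tw_D_lin]. Qed.

(** Induction on the derivation, with [k] and [u] general: the mode is commuted past the outermost
    positive mode. Each commutator term is a single mode on the inner vector, of weight at least T
    above the sum of the two weights. *)
Lemma tw_D_mode n k u x : tw_D n x -> tw_D (n - (k + T%:Z)) (Y k u x).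
Proof.
move=> Dx; elim: Dx k u => {n x}
  [n w n0 | n c x y _ IHx _ IHy | n | n l v x l0 Dx IH | m n x mn _ IH] k u.
- have [k0|k0] := ltP (k + T%:Z) 0; first exact/tw_D_mode_pos/tw_D_triv.
  by apply: tw_D_triv; lia.
- by rewrite linearPr; apply: tw_D_lin.
- by rewrite linear0r; apply: tw_D_0.
- apply: tw_commute; first exact: is_subspace_tw_D.
    move=> u'; apply: (tw_D_le _ (tw_D_mode_pos v l0 (IH k u'))); lia.
  move=> z j; apply: (tw_D_le _ (IH _ z)).
  have : 0 <= j%:Z * T%:Z by [].
  lia.
- by apply: (tw_D_le _ (IH k u)); lia.
Qed.

(** For n > 0 the constructor [tw_D_triv] cannot apply, so every vector comes from an outermost
    positive mode. *)
Lemma tw_D_gen n x : 0 < n -> tw_D n x ->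
  lspan [set z | exists k u y,
    [/\ k + T%:Z < 0, tw_D (n + (k + T%:Z)) y & z = Y k u y]] x.
Proof.
move=> n0 Dx; elim: Dx n0 => {n x}
  [n w n1 n0 | n c x y _ IHx _ IHy n0 | n _ | n k u x k0 Dx _ n0 | m n x mn _ IH m0].
- lia.
- by apply: (subspace_lspan _).2; [apply: IHx | apply: IHy].
- exact: (subspace_lspan _).1.
- by apply: lspan_gen; exists k, u, x; rewrite subrK.
- move: (IH (lt_le_trans m0 mn)); apply: lspan_sub; first exact: subspace_lspan.
  move=> _ [k [u [y [k0 Dy ->]]]]; apply: lspan_gen.
  by exists k, u, y; split=> //; apply: tw_D_le Dy; lia.
Qed.

(* Compare [tw_D_mode], which only gives [n - (k + T)]. *)
Lemma tw_D_C2 n k z x : va_C2 V z -> tw_D n x -> tw_D (n - k) (Y k z x).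
Proof.
move=> C2z Dx; have Ds m := is_subspace_tw_D m.
suff : va_C2 V `<=` [set z | tw_D (n - k) (Y k z x)] by apply.
apply: lspan_sub; first exact: is_subspace_mode_l.
move=> _ [u [v ->]] /=; move: u; apply: eigen_ind => [|r u ur].
  split=> [|c u1 u2 Du1 Du2] /=.
    by rewrite linear0l linear0l; case: (Ds (n - k)).
  by rewrite !linearPl; apply: tw_D_lin.
(* Right-hand side of the Jacobi identity at l = -2, a = r, b = k - r. This [a] satisfies the
   divisibility condition, and [F 0] is the mode of u_(-2)v under study. *)
pose F j := ((-1) ^+ j * gbinom (j%:R - 1 - (r : nat)%:Z%:~R / T%:R) j) *:
  Y ((r : nat)%:Z + (k - (r : nat)%:Z) - j%:Z * T%:Z) (va_mode V (- 2 + j%:Z) u v) x.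
have DF : tw_D (n - k) (\sum_(j \in [set: nat]) F j).
  (* Every product on the left has total weight -k, as l = -2 cancels the two shifts by T. *)
  have := tw_jacobi ur v x (- 2) (r : nat)%:Z (k - (r : nat)%:Z).
  rewrite subrr dvdz0 /= -/F => <-.
  apply: (subspaceB (Ds _)); apply: (subspace_fsum (Ds _)) => i;
    apply: (subspaceZ (Ds _)); apply: (tw_D_le _ (tw_D_mode _ _ (tw_D_mode _ _ Dx))); lia.
have [N NP] := va_trunc u v.
suff : tw_D (n - k) (F 0%N - \sum_(j \in [set: nat]) F j).
  move=> /(subspaceD (Ds _))/(_ DF).
  by rewrite subrK /F expr0 gbinom0r mulr1 scale1r mul0r subr0 addr0 subrKC.
apply: (@subspace_fsum_head _ _ (tw_D (n - k)) (absz (N + 2)%R) F) => // j.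
  by move=> Nj; rewrite /F NP ?linear0l ?scaler0 //; lia.
(* The term with index j + 1 is a mode of weight -k + jT. *)
apply: (subspaceZ (Ds _)); apply: (tw_D_le _ (tw_D_mode _ _ Dx)).
have : T%:Z <= j.+1%:Z * T%:Z by nia.
lia.
Qed.

(** * The spaces K_c and their comparison with D_n *)

(* C_m^T(W) is K_c for c = (m - 2) * T + 1.  Counting in steps of 1/T is what
   makes a product of two modes of weight c >= 1 gain something even at m = 2. *)
Definition tw_K (c : int) : set W :=
  lspan [set x | exists k u w, k + T%:Z <= - c /\ x = Y k u w].

Lemma tw_K_mode c k u w : k + T%:Z <= - c -> tw_K c (Y k u w).
Proof. by move=> kc; apply: lspan_gen; exists k, u, w. Qed.

(** In the Jacobi identity with exponents -1, k + T, l the product is the term i = 0 of the first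
    sum. The other terms of that sum, and all terms of the second, begin with a mode of weight at
    least c + T. The right-hand side consists of single modes of weight at least 2c, hence at least
    c + 1 since c > 0. *)
Lemma tw_K_mode_mode c k l u v w : 0 < c ->
  k + T%:Z <= - c -> l + T%:Z <= - c -> tw_K (c + 1) (Y k u (Y l v w)).
Proof.
move=> c0; rewrite le_eqVlt => /orP[/eqP kc lc|kc _]; last by apply: tw_K_mode; lia.
have Ks : is_subspace (tw_K (c + 1)) by exact: subspace_lspan.
move: u; apply: eigen_ind => [|r u ur]; first exact: is_subspace_mode_l.
move: v; apply: eigen_ind => [|s v vs].
  exact: (@is_subspace_mode_l [set w | tw_K (c + 1) (Y k u w)]
                              _ _ (is_subspace_mode_r _ _ Ks)).
have [N NP] := tw_mode_eventually0 l w vs.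
pose F i := ((-1) ^+ i * gbinom (- 1)%:~R i) *:
  Y (k + T%:Z + (- 1 - i%:Z) * T%:Z) u (Y (l + i%:Z * T%:Z) v w).
have KF : tw_K (c + 1) (\sum_(i \in [set: nat]) F i).
  have := tw_jacobi ur v w (- 1) (k + T%:Z) l.
  move=> /(canRL (subrK _)) /=; rewrite -/F => ->; apply: (subspaceD Ks).
    case: ifP => _; last by case: Ks.
    apply: (subspace_fsum Ks) => j; apply/(subspaceZ Ks)/tw_K_mode.
    have : 0 <= j%:Z * T%:Z by [].
    lia.
  apply: (subspace_fsum Ks) => j; apply/(subspaceZ Ks)/tw_K_mode.
  have : 0 <= j%:Z * T%:Z by [].
  lia.
suff : tw_K (c + 1) (F 0%N - \sum_(i \in [set: nat]) F i).
  move=> /(subspaceD Ks)/(_ KF).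
  rewrite subrK /F expr0 gbinom0r mulr1 scale1r mul0r subr0 addr0.
  by rewrite mulN1r addrK.
apply: (@subspace_fsum_head _ _ (tw_K (c + 1)) N F) => // j.
  by move=> Nj; rewrite /F NP ?linear0r ?scaler0.
apply/(subspaceZ Ks)/tw_K_mode.
have : T%:Z <= j.+1%:Z * T%:Z by nia.
lia.
Qed.

Lemma tw_D_sub_K (c : nat) : exists N : nat, tw_D N%:Z `<=` tw_K c.+1%:Z.
Proof.
elim: c => [|c [N DK]].
  exists 1%N => x /tw_D_gen-/(_ isT); apply: lspan_sub; first exact: subspace_lspan.
  by move=> _ [k [u [y [k0 _ ->]]]]; apply: tw_K_mode; lia.
(* [G j] records progress towards K_(c+2): the outer mode either is already good, or has weight at
   least c + 1 and acts on a vector of D_j. *)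
pose G j := lspan [set x | exists k u y, x = Y k u y /\
  (k + T%:Z <= - c.+2%:Z \/ k + T%:Z <= - c.+1%:Z /\ tw_D j y)].
have Gs j : is_subspace (G j) by exact: subspace_lspan.
have Gp j k u y : k + T%:Z <= - c.+2%:Z -> G j (Y k u y).
  by move=> kc; apply: lspan_gen; exists k, u, y; split=> //; left.
have DG (j : nat) : tw_D (N%:Z + j%:Z * c.+1%:Z) `<=` G j%:Z.
  elim: j => [|j IH] x.
    rewrite mul0r addr0 => /DK; apply: lspan_sub => //.
    move=> _ [k [u [w [kc ->]]]]; apply: lspan_gen; exists k, u, w.
    by split=> //; right; split=> //; apply: tw_D_triv.
  have jc : 0 < N%:Z + j.+1%:Z * c.+1%:Z by nia.
  move=> /(tw_D_gen jc); apply: lspan_sub => // _ [k [u [y [k0 Dy ->]]]].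
  (* Otherwise the mode has weight at most c + 1, so removing it costs at most one step of c + 1.
     Moved inside past the outer mode of a generator of [G j], it raises the inner vector from D_j
     to D_(j+1). *)
  have [kc|kc] := leP (k + T%:Z) (- c.+2%:Z); first exact: Gp.
  have : tw_D (N%:Z + j%:Z * c.+1%:Z) y by apply: tw_D_le Dy; nia.
  move=> /IH; suff : G j `<=` [set y | G j.+1 (Y k u y)] by apply.
  apply: lspan_sub; first exact: is_subspace_mode_r.
  move=> _ [l [v [z [-> lz]]]] /=; apply: tw_commute => // [u'|z' i].
    case: lz => [lc|[lc Dz]]; first exact: Gp.
    apply: lspan_gen; exists l, v, (Y k u' z); split=> //; right; split=> //.
    by apply: (tw_D_le _ (tw_D_mode _ _ Dz)); lia.
  apply: Gp; have : 0 <= i%:Z * T%:Z by [].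
  case: lz => [lc|[lc _]]; lia.
(* Taking j = N puts the inner vector in D_N, hence in K_(c+1), and two modes of weight at least c +
   1 then meet. *)
exists (N + N * c.+1)%N => x; rewrite PoszD PoszM => /DG.
apply: lspan_sub; first exact: subspace_lspan.
move=> _ [k [u [y [-> [kc|[kc /DK Ky]]]]]]; first exact: tw_K_mode.
have -> : c.+2%:Z = c.+1%:Z + 1 by lia.
move: Ky; suff : tw_K c.+1%:Z `<=` [set y | tw_K (c.+1%:Z + 1) (Y k u y)] by apply.
apply: lspan_sub; first exact/is_subspace_mode_r/subspace_lspan.
by move=> _ [l [v [w [lc ->]]]]; apply: tw_K_mode_mode.
Qed.

(** * The derivative property and the inclusions among the C_n *)

(** This is (Du)_n = -n u_(n-1) for Du = u_(-2)1 and n = a/T. With the vacuum as second vector and l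
    = -2, b = 0, the left-hand side of the Jacobi identity vanishes and only j = 0, 1 survive on the
    right. *)
Lemma tw_derivative (r : 'I_T) u a w :
  eigen g T r u -> (T%:Z %| a - (r : nat)%:Z)%Z ->
  Y a (va_mode V (- 2) u (va_vac V)) w = - (a%:~R / T%:R) *: Y (a - T%:Z) u w.
Proof.
move=> ur ar; have := tw_jacobi ur (va_vac V) w (- 2) a 0.
rewrite ar [X in X - _ = _]fsbig1 /=; last first.
  move=> i _; rewrite tw_vacuum ifF ?linear0r ?scaler0 //.
  have : 0 <= i%:Z * T%:Z by [].
  lia.
rewrite [X in _ - X = _]fsbig1 /=; last first.
  by move=> i _; rewrite tw_vacuum ifF ?scaler0 //; nia.
have [u1 u0] := va_creation u.
rewrite subrr (@fsum_nat _ _ 2) => [|i i2]; last first.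
  by rewrite u0 ?linear0l ?scaler0 //; lia.
rewrite big_ord_recl big_ord1 /= /bump /= !addn0 expr0 expr1 gbinom0r gbinom1r.
have -> : a + 0 - 0%:Z * T%:Z = a by lia.
have -> : a + 0 - 1%:Z * T%:Z = a - T%:Z by lia.
rewrite mulr1 scale1r addr0 subrr sub0r mulN1r opprK.
rewrite (_ : - 2 + 1%:Z = - 1) // u1 => /esym/(canRL (addrK _)) ->.
by rewrite sub0r scaleNr.
Qed.

Lemma tw_C_le m n : (0 < m <= n)%N -> tw_C W n `<=` tw_C W m.
Proof.
move=> /andP[m0]; elim: n => [|n IH]; first by lia.
rewrite leq_eqVlt => /orP[/eqP-> //|mn]; apply: subset_trans (IH mn).
apply: lspan_sub; first exact: subspace_lspan.
move=> _ [p [u [w [up ->]]]].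
pose a := - (n%:Z * T%:Z) + (p : nat)%:Z.
(* The derivative formula is to be divided by [a], which is negative since p < T and n >= 1. *)
have a0 : a != 0.
  have := ltn_ord p; have : T%:Z <= n%:Z * T%:Z by nia.
  rewrite /a; lia.
have -> : - (n.+1%:Z * T%:Z) + (p : nat)%:Z = a - T%:Z by rewrite /a; lia.
have ap : (T%:Z %| a - (p : nat)%:Z)%Z.
  by apply/dvdzP; exists (- n%:Z); rewrite /a addrK mulNr.
have a0' : - (a%:~R / T%:R) != 0 :> R[i].
  by rewrite oppr_eq0 mulf_neq0 ?intr_eq0 // invr_eq0 pnatr_eq0 -lt0n.
rewrite -[Y _ u w]scale1r -(mulVf a0') -scalerA -(tw_derivative w up ap).
apply/(subspaceZ (subspace_lspan _))/lspan_gen.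
exists p, (va_mode V (- 2) u (va_vac V)), w; split=> //.
case: g_aut => _ gY; rewrite /eigen /= gY up.
have := eigen_vac T g_aut; rewrite /eigen /= exp_2ipi0 scale1r => ->.
by rewrite linearZl_LR.
Qed.

Lemma tw_K_sub_C (m : nat) : (1 < m)%N -> tw_K ((m%:Z - 2) * T%:Z + 1) `<=` tw_C W m.
Proof.
move=> m1; have Cs n : is_subspace (tw_C W n) by exact: subspace_lspan.
apply: lspan_sub => // _ [k [u [w [km ->]]]].
move: u; apply: eigen_ind => [|p u up]; first exact: is_subspace_mode_l.
have [kp|kp] := boolP (T%:Z %| k - (p : nat)%:Z)%Z; last first.
  by rewrite (tw_support up kp); case: (Cs m).
have /dvdzP[q kq] := kp.
(* Here k <= -(m - 1)T - 1 and k = qT + p with p >= 0, so q < -(m - 1). *)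
have mq : m%:Z <= - q.
  rewrite leNgt; apply/negP => qm.
  have : 0 <= (m%:Z - 1 + q) * T%:Z by rewrite mulr_ge0 //; lia.
  have := ltn_ord p; nia.
apply: (@tw_C_le m `|q|%N); first by lia.
apply: lspan_gen; exists p, u, w; split=> //; congr (tw_mode W _ u w); nia.
Qed.

(** * Comparison with E_n and C_2, and finite codimension of D_n *)

Lemma tw_D_sub_E (n : int) : tw_D n `<=` tw_E W n.
Proof.
have Es m : is_subspace (tw_E W m) by exact: subspace_lspan.
move=> x; elim=> {n x}
  [n w n0 | n c x y _ Ex _ Ey | n | n k u x k0 _ Ex | m n x mn _ Ex].
(* Words in E_n are nonempty, so the empty word is replaced by 1_(-1), which has weight 0 and acts
   as the identity. *)
- apply: lspan_gen; exists [:: (va_vac V, Ordinal T_gt0, 0%N)], w; split=> //.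
  + by move=> f; rewrite inE => /eqP ->; apply: eigen_vac.
  + by rewrite big_seq1 mul0r subr0.
  + by rewrite /= tw_vacuum ifT //; lia.
- exact: (Es n).2.
- exact: (Es n).1.
- move: u; apply: eigen_ind => [|r u ur]; first exact: is_subspace_mode_l.
  have [kr|kr] := boolP (T%:Z %| k - (r : nat)%:Z)%Z; last first.
    by rewrite (tw_support ur kr); exact: (Es _).1.
  have /dvdzP[q kq] := kr.
  have q1 : q + 1 < 0 by rewrite ltNge; apply/negP; nia.
  pose j := absz (- 1 - q)%R.
  have jq : j%:Z = - 1 - q by rewrite /j; lia.
  have kE : k = (- 1 - j%:Z) * T%:Z + (r : nat)%:Z by rewrite jq; lia.
  suff : tw_E W n `<=` [set x | tw_E W (n - (k + T%:Z)) (Y k u x)] by apply.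
  apply: lspan_sub; first exact: is_subspace_mode_r.
  move=> _ [s [w [s1 sE sn ->]]]; apply: lspan_gen; exists ((u, r, j) :: s), w.
  split=> //.
  + by move=> f; rewrite inE => /orP[/eqP->//|]; apply: sE.
  + rewrite big_cons /= (_ : n - _ = j%:Z * T%:Z - (r : nat)%:Z + n) ?lerD2l //.
    by rewrite kE; ring.
  + by rewrite /= -kE.
- move: Ex; apply: lspan_sub => // _ [s [w [s1 sE sn ->]]].
  by apply: lspan_gen; exists s, w; split=> //; apply: le_trans sn.
Qed.

Lemma tw_C2_sub_D : tw_C W 2 `<=` tw_D 1.
Proof.
apply: lspan_sub; first exact: is_subspace_tw_D.
move=> _ [p [u [w [_ ->]]]]; have pT := ltn_ord p.
apply: (tw_D_le _ (tw_D_mode _ _ (tw_D_triv _ (lexx 0)))); lia.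
Qed.

Lemma tw_D_cofinite (n : nat) :
  finite_codim (va_C2 V) -> finite_codim (tw_C W 2) -> finite_codim (tw_D n.+1%:Z).
Proof.
move=> /finite_codimP[f fP] W2; elim: n => [|n /finite_codimP[s sP]].
  exact: finite_codim_sub tw_C2_sub_D W2.
apply/finite_codimP.
(* The mode with numerator -i - T has weight i; only the weights 1 to n + 1 are not already absorbed
   by D_(n+2). *)
pose t := flatten [seq [seq Y (- i%:Z - T%:Z) u e | u <- f, e <- s] | i <- iota 1 n.+1].
exists (s ++ t) => x.
have Ds := is_subspace_tw_D n.+2%:Z.
have Ps := subspace_span_plus (s ++ t) Ds.
have [e Le Dxe] := sP x; rewrite -(subrKC e x); apply: (subspaceD Ps).
  apply: span_plus_l; first exact: tw_D_0.
  apply: lspan_sub Le => [|y /= ys]; first exact: subspace_lspan.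
  by apply: lspan_gen; rewrite /= mem_cat ys.
move: {e Le} (x - e) Dxe => {}x /tw_D_gen-/(_ isT).
apply: lspan_sub => // _ [k [u [y [k0 Dy ->]]]].
have [kn|kn] := leP (k + T%:Z) (- n.+2%:Z).
  apply: span_plus_r; apply: (tw_D_le _ (tw_D_mode _ _ (tw_D_triv _ (lexx 0)))); lia.
(* Replacing [u] by [u'] costs an element of D_(n+1+T). Replacing [y] by [y'] modulo D_(n+1) costs
   one of D_(n+2), since the mode has weight at least 1. *)
have [u' Lu' C2u] := fP u; rewrite -(subrKC u' u) linearDl.
apply: (subspaceD Ps); last first.
  by apply: span_plus_r; apply: (tw_D_le _ (tw_D_C2 k C2u Dy)); lia.
have [y' Ly' Dy'] := sP y; rewrite -(subrKC y' y) linearDr.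
apply: (subspaceD Ps); last first.
  by apply: span_plus_r; apply: (tw_D_le _ (tw_D_mode k u' Dy')); lia.
apply: span_plus_l; first exact: tw_D_0.
have Ls : is_subspace (lspan [set` s ++ t]) by exact: subspace_lspan.
suff : lspan [set` f] `<=` [set u | lspan [set` s ++ t] (Y k u y')] by apply.
apply: lspan_sub => [|v /= vf]; first exact: is_subspace_mode_l.
suff : lspan [set` s] `<=` [set y | lspan [set` s ++ t] (Y k v y)] by apply.
apply: lspan_sub => [|z /= zs]; first exact: is_subspace_mode_r.
apply: lspan_gen; rewrite /= mem_cat; apply/orP; right.
apply/flatten_mapP; exists (absz (k + T%:Z)%R); first by rewrite mem_iota; lia.
have -> : k = - (absz (k + T%:Z)%R)%:Z - T%:Z by lia.
rewrite (_ : absz _ = absz (k + T%:Z)%R); last lia.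
exact: (allpairs_f (fun u e => Y _ u e)).
Qed.

End TwistedModule.

Theorem proposition6p4 (R : realType) (V : vertexAlgebra R)
    (g : {linear V -> V}) (T : nat)
    (g_aut : va_automorphism g) (g_period : has_period g T)
    (W : twistedModule g T)
    (V_C2_cofinite : finite_codim (va_C2 V))
    (W_C2_cofinite : finite_codim (tw_C W 2)) :
  forall n : nat,
    finite_codim (tw_E W (Posz n)) /\ finite_codim (tw_C W n.+2).
Proof.
move=> n.
have cofinite_D (m : nat) : finite_codim (@tw_D _ _ _ _ W m%:Z).
  apply: finite_codim_sub _ (tw_D_cofinite g_period m V_C2_cofinite W_C2_cofinite).
  by move=> x; apply: tw_D_le; lia.
split.
  by apply: finite_codim_sub _ (cofinite_D n); exact: tw_D_sub_E.
(* For m = n + 2 the bound (m - 2)T + 1 is nT + 1. *)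
have [N DK] := tw_D_sub_K g_period W (n * T).
apply: finite_codim_sub _ (cofinite_D N) => x /DK Kx.
apply: (tw_K_sub_C g_aut g_period (isT : (1 < n.+2)%N)).
by rewrite (_ : _ + 1 = (n * T).+1%:Z) //; lia.
Qed.
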